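(* Let $F$ be a field of characteristic $\neq 2$, let $O$ be a Cayley algebra over $F$, $V=\operatorname{im}(O)$, and let $\mathcal{B}$ be the set of all three-dimensional associative subspaces of $V$. Then $(V,\mathcal{B})$ is a $(7,3,2)$ $q$-covering design which is inclusion-minimal (no proper subcollection of $\mathcal{B}$ covers all 2-dimensional subspaces of $V$), and it is a $2$-$(7,3,1)$ subspace design ($q$-Fano plane) if and only if $O$ is a division algebra. Moreover $\mathcal{B}=\{\operatorname{im}(H): H \text{ a 4-dimensional subalgebra of } O\}$.
   Context: All algebras are finite-dimensional unital, not necessarily associative $F$-algebras; subalgebras contain $1$. Cayley–Dickson algebras: $F$ with identity involution; if $A$ is one with involution $*$ and $\gamma\in F^\times$, then $D_\gamma(A)=A\oplus A$ (elements $a+ib$) with $(a+ib)(c+id)=(ac+\gamma db^* )+i(a^*d+cb)$ and $(a+ib)^*=a^*-ib$. A Cayley algebra is $D_\gamma(D_\beta(D_\alpha(F)))$, $\alpha,\beta,\gamma\in F^\times$; $\operatorname{im}(O)=\{a: a^*=-a\}$. A linear subspace $S$ of an algebra is associative if $(xy)z=x(yz)$ for all $x,y,z\in S$ (the products need not lie in $S$). A division algebra has no zero divisors. A $(v,k,t)$ $q$-covering design: a set of $k$-dimensional subspaces of a $v$-dimensional space such that every $t$-dimensional subspace lies in at least one of them; a $2$-$(7,3,1)$ subspace design: every 2-dimensional subspace lies in exactly one. *)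

(* Defs.v *)
From HB Require Import structures.
From mathcomp Require Import all_boot all_order all_algebra.
Set Implicit Arguments. Unset Strict Implicit. Unset Printing Implicit Defensive.
Import Order.TTheory GRing.Theory.
Local Open Scope ring_scope.

(* Cayley--Dickson doubling, realised on row vectors: the element a + i b of
   D_g(A) (A realised on 'rV_n) is the row vector row_mx a b : 'rV_(n+n). *)
Definition cd_mul (F : fieldType) (n : nat)
  (mul : 'rV[F]_n -> 'rV[F]_n -> 'rV[F]_n) (conj : 'rV[F]_n -> 'rV[F]_n)
  (g : F) (x y : 'rV[F]_(n + n)) : 'rV[F]_(n + n) :=
  let a := lsubmx x in let b := rsubmx x in
  let c := lsubmx y in let d := rsubmx y in
  row_mx (mul a c + g *: mul d (conj b)) (mul (conj a) d + mul c b).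

Definition cd_conj (F : fieldType) (n : nat) (conj : 'rV[F]_n -> 'rV[F]_n)
  (x : 'rV[F]_(n + n)) : 'rV[F]_(n + n) :=
  row_mx (conj (lsubmx x)) (- rsubmx x).

Definition cd_one (F : fieldType) (n : nat) (one : 'rV[F]_n) : 'rV[F]_(n + n) :=
  row_mx one 0.

Definition mul1 (F : fieldType) (x y : 'rV[F]_1) : 'rV[F]_1 := x *m y.
Definition conj1 (F : fieldType) (x : 'rV[F]_1) : 'rV[F]_1 := x.
Definition one1 (F : fieldType) : 'rV[F]_1 := 1%:M.

Definition mul2 (F : fieldType) (al : F) := cd_mul (@mul1 F) (@conj1 F) al.
Definition conj2 (F : fieldType) := cd_conj (@conj1 F).
Definition mul4 (F : fieldType) (al be : F) := cd_mul (mul2 al) (@conj2 F) be.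
Definition conj4 (F : fieldType) := cd_conj (@conj2 F).

(* The Cayley algebra O = D_ga(D_be(D_al(F))), carrier 'rV[F]_8. *)
Definition Omul (F : fieldType) (al be ga : F) : 'rV[F]_8 -> 'rV[F]_8 -> 'rV[F]_8 :=
  cd_mul (mul4 al be) (@conj4 F) ga.
Definition Oconj (F : fieldType) : 'rV[F]_8 -> 'rV[F]_8 := cd_conj (@conj4 F).
Definition Oone (F : fieldType) : 'rV[F]_8 := cd_one (cd_one (cd_one (one1 F))).

(* im(O) = { a | a^* = -a } = kernel of the (linear) map a |-> a^* + a *)
Definition Oim (F : fieldType) : {vspace 'rV[F]_8} :=
  lker (linfun (fun x : 'rV[F]_8 => Oconj x + x)).

Definition assoc_subspace (F : fieldType) (al be ga : F) (S : {vspace 'rV[F]_8}) :=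
  forall x y z, x \in S -> y \in S -> z \in S ->
    Omul al be ga (Omul al be ga x y) z = Omul al be ga x (Omul al be ga y z).

Definition subalgebra (F : fieldType) (al be ga : F) (H : {vspace 'rV[F]_8}) :=
  Oone F \in H /\ forall x y, x \in H -> y \in H -> Omul al be ga x y \in H.

Definition division_alg (F : fieldType) (al be ga : F) :=
  forall x y : 'rV[F]_8, Omul al be ga x y = 0 -> x = 0 \/ y = 0.

Definition assoc_blocks (F : fieldType) (al be ga : F) (S : {vspace 'rV[F]_8}) :=
  [/\ (S <= Oim F)%VS, \dim S = 3%N & assoc_subspace al be ga S].

Definition covers (K : fieldType) (vT : vectType K) (W : {vspace vT}) (t : nat)
  (Bl : {vspace vT} -> Prop) :=
  forall T : {vspace vT}, (T <= W)%VS -> \dim T = t ->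
    exists S, Bl S /\ (T <= S)%VS.

Definition q_covering_design (K : fieldType) (vT : vectType K) (W : {vspace vT})
  (v k t : nat) (Bl : {vspace vT} -> Prop) :=
  [/\ \dim W = v,
      (forall S, Bl S -> (S <= W)%VS /\ \dim S = k) & covers W t Bl].

Definition covering_minimal (K : fieldType) (vT : vectType K) (W : {vspace vT})
  (t : nat) (Bl : {vspace vT} -> Prop) :=
  forall Bl' : {vspace vT} -> Prop, (forall S, Bl' S -> Bl S) ->
    (exists S, Bl S /\ ~ Bl' S) -> ~ covers W t Bl'.

Definition subspace_design1 (K : fieldType) (vT : vectType K) (W : {vspace vT})
  (v k t : nat) (Bl : {vspace vT} -> Prop) :=
  [/\ \dim W = v,
      (forall S, Bl S -> (S <= W)%VS /\ \dim S = k) &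
      forall T : {vspace vT}, (T <= W)%VS -> \dim T = t ->
        exists! S, Bl S /\ (T <= S)%VS].

(* Main.v *)
Require Import Defs.
From HB Require Import structures.
From mathcomp Require Import all_boot all_order all_algebra.
From mathcomp Require Import ring zify.

(* Write V = im(O), and x y = cross x y - dot x y on V. The proof rests on three facts.
   (1) Every 3-dimensional subspace of V contains x, y with cross x y outside
   <x, y>. Otherwise cross x y = l(x) y - l(y) x for a linear form l, and the
   vectors x + l(x) span a 3-dimensional space on which x^* y = 0. For a
   dot-dual family v_i of a basis x_j of such a space, the nine products
   v_i^* x_j are linearly independent, although dim O = 8.
   (2) If cross x y is not in <x, y>, then the associator [x, y, z] vanishes for z in V
   only when z lies in <x, y, cross x y>; so that span is the only block
   containing x and y.
   (3) For independent x, y in V, the form ([x, y, u], v) is skew with 1, x, y in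
   its radical, and is therefore degenerate on a 5-dimensional complement; so
   every plane lies in a block.
   By (1) every block is the block of (2) for one of its planes, which gives
   minimality and the description by subalgebras. If O has zero divisors, there
   is a plane <y, z> in V with y z = 0, and every x in V orthogonal to it
   completes it to a block. *)

Set Implicit Arguments. Unset Strict Implicit. Unset Printing Implicit Defensive.
Import GRing.Theory.
Local Open Scope ring_scope.

(** * Linear maps given as plain functions *)

(** Gives access to kernels and ranks of bare functions, such as a left multiplication, once their
    linearity is proved. *)
Lemma linfunE (F : fieldType) (U V : vectType F) (f : U -> V) :
  linear f -> linfun f =1 f.
Proof.
move=> lf x; pose g : {linear U -> V} :=
  HB.pack_for {linear U -> V} f (GRing.isLinear.Build _ _ _ _ f lf).
by rewrite -[f]/(g : U -> V) lfunE.
Qed.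

Lemma linear_span0 (F : fieldType) (U V : vectType F) (f : U -> V) (X : seq U) :
  linear f -> {in X, forall v, f v = 0} -> {in <<X>>%VS, forall v, f v = 0}.
Proof.
move=> lf f0 v Xv; rewrite -(linfunE lf); apply/eqP; rewrite -memv_ker.
have /subvP : (<<X>> <= lker (linfun f))%VS.
  by apply/span_subvP => u Xu; rewrite memv_ker linfunE // f0.
exact.
Qed.

(** * The doubling in eight scalar coordinates *)

Section Coordinates.
Variables (F : fieldType) (al be ga : F).
Implicit Types (a b c d e f g h : F) (x y z t u v : 'rV[F]_8).

Definition quat a b c d : 'rV[F]_4 :=
  row_mx (row_mx a%:M b%:M : 'rV[F]_(1 + 1)) (row_mx c%:M d%:M : 'rV[F]_(1 + 1)).

Definition oct a b c d e f g h : 'rV[F]_8 := row_mx (quat a b c d) (quat e f g h).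

Variant oct_spec : 'rV[F]_8 -> Prop :=
  OctSpec a b c d e f g h : oct_spec (oct a b c d e f g h).

(** Case analysis with this view replaces an element by its coordinates, so that an identity becomes
    polynomial and falls to [ring]. *)
Lemma octP x : oct_spec x.
Proof.
have -> : x = row_mx (@lsubmx _ 1 4 4 x) (@rsubmx _ 1 4 4 x) by rewrite hsubmxK.
move: (lsubmx _) (rsubmx _) => y z.
have q (u : 'rV[F]_4) : exists a b c d, u = quat a b c d.
  pose l := @lsubmx F 1 (1 + 1) (1 + 1) u; pose r := @rsubmx F 1 (1 + 1) (1 + 1) u.
  exists (lsubmx l 0 0), (rsubmx l 0 0), (lsubmx r 0 0), (rsubmx r 0 0).
  by rewrite /quat -!mx11_scalar !hsubmxK.
by have [a [b [c [d ->]]]] := q y; have [e [f [g [h ->]]]] := q z; apply: OctSpec.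
Qed.

Lemma quatD a b c d a' b' c' d' :
  quat a b c d + quat a' b' c' d' = quat (a + a') (b + b') (c + c') (d + d').
Proof. by rewrite /quat !raddfD /= -!add_row_mx. Qed.

Lemma quatZ k a b c d :
  k *: quat a b c d = quat (k * a) (k * b) (k * c) (k * d).
Proof.
apply: etrans (@scale_row_mx F 1 (1 + 1) (1 + 1) k _ _) _.
by rewrite /quat !scale_row_mx !scale_scalar_mx.
Qed.

Lemma quatN a b c d : - quat a b c d = quat (- a) (- b) (- c) (- d).
Proof. by rewrite -scaleN1r quatZ !mulN1r. Qed.

Lemma quatC a b c d : conj4 (quat a b c d) = quat a (- b) (- c) (- d).
Proof.
by rewrite /conj4 /conj2 /cd_conj /conj1 /quat !(row_mxKl, row_mxKr) !raddfN /= !opp_row_mx.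
Qed.

Lemma quatM a b c d a' b' c' d' :
  mul4 al be (quat a b c d) (quat a' b' c' d') =
  quat (a * a' + al * b * b' + be * c * c' - al * be * d * d')
       (a * b' + b * a' - be * d * c' + be * c * d')
       (a * c' + c * a' - al * b * d' + al * d * b')
       (a * d' - b * c' + d * a' + c * b').
Proof.
have sD (u v : F) : u%:M + v%:M = (u + v)%:M :> 'rV[F]_1 by rewrite raddfD.
have sN (u : F) : - u%:M = (- u)%:M :> 'rV[F]_1 by rewrite raddfN.
rewrite /mul4 /mul2 /mul1 /conj2 /cd_mul /cd_conj /conj1 /quat.
rewrite !(row_mxKl, row_mxKr, opp_row_mx, scale_row_mx, add_row_mx).
rewrite !(sN, mul_scalar_mx, scale_scalar_mx, sD).
by congr (row_mx (row_mx _%:M _%:M) (row_mx _%:M _%:M)); ring.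
Qed.

Lemma octD a b c d e f g h a' b' c' d' e' f' g' h' :
  oct a b c d e f g h + oct a' b' c' d' e' f' g' h' =
  oct (a + a') (b + b') (c + c') (d + d') (e + e') (f + f') (g + g') (h + h').
Proof. by rewrite /oct -!quatD -add_row_mx. Qed.

Lemma octZ k a b c d e f g h :
  k *: oct a b c d e f g h =
  oct (k * a) (k * b) (k * c) (k * d) (k * e) (k * f) (k * g) (k * h).
Proof.
by apply: etrans (@scale_row_mx F 1 4 4 k _ _) _; rewrite !quatZ.
Qed.

Lemma octN a b c d e f g h :
  - oct a b c d e f g h = oct (- a) (- b) (- c) (- d) (- e) (- f) (- g) (- h).
Proof. by rewrite -scaleN1r octZ !mulN1r. Qed.

Lemma oct0 : 0 = oct 0 0 0 0 0 0 0 0 :> 'rV[F]_8.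
Proof. by rewrite /oct /quat !raddf0 !row_mx0. Qed.

Lemma oct1 : Oone F = oct 1 0 0 0 0 0 0 0.
Proof. by rewrite /Oone /cd_one /one1 /oct /quat !raddf0 !row_mx0. Qed.

Lemma octC a b c d e f g h :
  Oconj (oct a b c d e f g h) = oct a (- b) (- c) (- d) (- e) (- f) (- g) (- h).
Proof. by rewrite /Oconj /cd_conj /oct row_mxKl row_mxKr quatC quatN. Qed.

Lemma octM a b c d e f g h a' b' c' d' e' f' g' h' :
  Omul al be ga (oct a b c d e f g h) (oct a' b' c' d' e' f' g' h') =
  oct
   (a * a' + al * b * b' + be * c * c' - al * be * d * d' + ga * e * e'
     - al * ga * f * f' - be * ga * g * g' + al * be * ga * h * h')
   (a * b' + b * a' - be * d * c' + be * c * d' - ga * f * e' + ga * e * f'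
     + be * ga * g * h' - be * ga * h * g')
   (a * c' + c * a' - al * b * d' + al * d * b' - ga * g * e' + al * ga * h * f'
     + ga * e * g' - al * ga * f * h')
   (a * d' - b * c' + d * a' + c * b' - ga * h * e' + ga * g * f' + ga * e * h'
     - ga * f * g')
   (a * e' + e * a' - al * b * f' - be * c * g' + al * be * d * h' + al * f * b'
     + be * g * c' - al * be * h * d')
   (a * f' - b * e' + f * a' + e * b' + be * d * g' - be * c * h' - be * g * d'
     + be * h * c')
   (a * g' - c * e' + g * a' + e * c' + al * b * h' - al * d * f' - al * h * b'
     + al * f * d')
   (a * h' + b * g' - d * e' - c * f' + h * a' - g * b' + e * d' + f * c').
Proof.
rewrite /Omul /cd_mul /oct !row_mxKl !row_mxKr !quatC !quatM !quatZ !quatD.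
by congr (row_mx (quat _ _ _ _) (quat _ _ _ _)); ring.
Qed.

(** The scalar part: the coefficient of the unit. *)
Definition ore x : F := lsubmx (@lsubmx F 1 (1 + 1) (1 + 1) (@lsubmx F 1 4 4 x)) 0 0.

Lemma octRe a b c d e f g h : ore (oct a b c d e f g h) = a.
Proof. by rewrite /ore /oct /quat !row_mxKl mxE. Qed.

End Coordinates.

(** * Identities verified in coordinates *)

Section Identities.
Variables (F : fieldType) (al be ga : F).
Implicit Types (k : F) (x y z t u v w : 'rV[F]_8).

Local Notation "x ** y" := (Omul al be ga x y) (at level 40, left associativity).
Local Notation one := (Oone F).

(* Locked, so that no unification problem can unfold them to matrix entries. *)
Fact form_key : unit. Proof. exact: tt. Qed.
(** The polar form of the norm: [dot x x] is the scalar [x x^*], and [x y^* + y x^*] is [2 dot x y]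
    times the unit. *)
Definition dot := locked_with form_key (fun x y : 'rV[F]_8 => ore (x ** Oconj y)).
Definition cross := locked_with form_key
  (fun x y : 'rV[F]_8 => x ** y - ore (x ** y) *: one).
Definition asc := locked_with form_key
  (fun x y z : 'rV[F]_8 => (x ** y) ** z - x ** (y ** z)).

Lemma dot_def x y : dot x y = ore (x ** Oconj y).
Proof. by rewrite /dot; case: form_key. Qed.

Lemma cross_def x y : cross x y = x ** y - ore (x ** y) *: one.
Proof. by rewrite /cross; case: form_key. Qed.

Lemma asc_def x y z : asc x y z = (x ** y) ** z - x ** (y ** z).
Proof. by rewrite /asc; case: form_key. Qed.

Lemma octB (a b c d e f g h a' b' c' d' e' f' g' h' : F) :
  dot (oct a b c d e f g h) (oct a' b' c' d' e' f' g' h') =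
  a * a' - al * b * b' - be * c * c' + al * be * d * d' - ga * e * e'
   + al * ga * f * f' + be * ga * g * g' - al * be * ga * h * h'.
Proof. by rewrite dot_def octC octM octRe; ring. Qed.

(* The rewriting steps match syntactically: unifying [oct _ .. _] against an
   unevaluated operation would unfold both down to matrices. *)
Ltac octs := repeat match goal with x : matrix _ _ _ |- _ => case: (octP x) => {x} * end.
Ltac oct_rewrite l E := generalize (E : l = _); generalize l; intros ? ->.
Ltac octsimpl := rewrite ?oct1; repeat match goal with
  | |- context [Oconj (oct ?a ?b ?c ?d ?e ?f ?g ?h)] =>
      oct_rewrite (Oconj (oct a b c d e f g h)) (octC a b c d e f g h)
  | |- context [ore (oct ?a ?b ?c ?d ?e ?f ?g ?h)] =>
      oct_rewrite (ore (oct a b c d e f g h)) (octRe a b c d e f g h)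
  | |- context [Omul al be ga (oct ?a ?b ?c ?d ?e ?f ?g ?h) (oct ?a' ?b' ?c' ?d' ?e' ?f' ?g' ?h')] =>
      oct_rewrite (Omul al be ga (oct a b c d e f g h) (oct a' b' c' d' e' f' g' h'))
        (octM al be ga a b c d e f g h a' b' c' d' e' f' g' h')
  | |- context [dot (oct ?a ?b ?c ?d ?e ?f ?g ?h) (oct ?a' ?b' ?c' ?d' ?e' ?f' ?g' ?h')] =>
      oct_rewrite (dot (oct a b c d e f g h) (oct a' b' c' d' e' f' g' h'))
        (octB a b c d e f g h a' b' c' d' e' f' g' h')
  | |- context [@GRing.scale ?R ?V ?k (oct ?a ?b ?c ?d ?e ?f ?g ?h)] =>
      oct_rewrite (@GRing.scale R V k (oct a b c d e f g h)) (octZ k a b c d e f g h)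
  | |- context [@GRing.opp ?V (oct ?a ?b ?c ?d ?e ?f ?g ?h)] =>
      oct_rewrite (@GRing.opp V (oct a b c d e f g h)) (octN a b c d e f g h)
  | |- context [@GRing.add ?V (oct ?a ?b ?c ?d ?e ?f ?g ?h) (oct ?a' ?b' ?c' ?d' ?e' ?f' ?g' ?h')] =>
      oct_rewrite (@GRing.add V (oct a b c d e f g h) (oct a' b' c' d' e' f' g' h'))
        (octD a b c d e f g h a' b' c' d' e' f' g' h')
  end.
Ltac octring := intros; octs; octsimpl; try (congr oct); ring.

Lemma oreDZ k x y : ore (k *: x + y) = k * ore x + ore y.
Proof. octring. Qed.

Lemma oconjDZ k x y : Oconj (k *: x + y) = k *: Oconj x + Oconj y.
Proof. octring. Qed.

Lemma omulDZl k x y z : (k *: x + y) ** z = k *: (x ** z) + y ** z.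
Proof. octring. Qed.

Lemma omulDZr k x y z : x ** (k *: y + z) = k *: (x ** y) + x ** z.
Proof. octring. Qed.

Lemma dotC x y : dot x y = dot y x. Proof. octring. Qed.
Lemma dotDl x y z : dot (x + y) z = dot x z + dot y z. Proof. octring. Qed.
Lemma dotZl k x y : dot (k *: x) y = k * dot x y. Proof. octring. Qed.
Lemma dotNl x y : dot (- x) y = - dot x y. Proof. octring. Qed.
Lemma dot0l x : dot 0 x = 0. Proof. by rewrite -(scale0r 0) dotZl mul0r. Qed.
Lemma dotDr x y z : dot x (y + z) = dot x y + dot x z. Proof. octring. Qed.
Lemma dotZr k x y : dot x (k *: y) = k * dot x y. Proof. octring. Qed.
Lemma dotNr x y : dot x (- y) = - dot x y. Proof. octring. Qed.
Lemma dot0r x : dot x 0 = 0. Proof. by rewrite dotC dot0l. Qed.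
Definition dotE := (dotDl, dotZl, dotNl, dot0l, dotDr, dotZr, dotNr, dot0r).

Lemma crossDl x y z : cross (x + y) z = cross x z + cross y z.
Proof. rewrite !cross_def; octring. Qed.
Lemma crossZl k x y : cross (k *: x) y = k *: cross x y.
Proof. rewrite !cross_def; octring. Qed.
Lemma crossNl x y : cross (- x) y = - cross x y.
Proof. by rewrite -scaleN1r crossZl scaleN1r. Qed.
Lemma cross0l x : cross 0 x = 0.
Proof. by apply: (addrI (cross 0 x)); rewrite -crossDl !addr0. Qed.
Lemma crossDr x y z : cross x (y + z) = cross x y + cross x z.
Proof. rewrite !cross_def; octring. Qed.
Lemma crossZr k x y : cross x (k *: y) = k *: cross x y.
Proof. rewrite !cross_def; octring. Qed.
Lemma crossNr x y : cross x (- y) = - cross x y.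
Proof. by rewrite -scaleN1r crossZr scaleN1r. Qed.
Lemma cross0r x : cross x 0 = 0.
Proof. by apply: (addrI (cross x 0)); rewrite -crossDr !addr0. Qed.
Definition crossE :=
  (crossDl, crossZl, crossNl, cross0l, crossDr, crossZr, crossNr, cross0r).

Lemma ascDZ1 k x y z t : asc (k *: x + y) z t = k *: asc x z t + asc y z t.
Proof.
rewrite !asc_def (omulDZl k x y z) (omulDZl k (x ** z)) (omulDZl k x y (z ** t)).
move: (_ ** _ ** t) (_ ** _ ** t) (_ ** (_ ** _)) (_ ** (_ ** _)) => p q r s.
by rewrite opprD scalerBr addrACA.
Qed.

Lemma ascDZ2 k x y z t : asc z (k *: x + y) t = k *: asc z x t + asc z y t.
Proof.
rewrite !asc_def (omulDZl k x y t) (omulDZr k z x y) (omulDZr k z (x ** t)).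
rewrite (omulDZl k (z ** x)).
move: (_ ** _ ** t) (_ ** _ ** t) (_ ** (_ ** _)) (_ ** (_ ** _)) => p q r s.
by rewrite opprD scalerBr addrACA.
Qed.

Lemma ascDZ3 k x y z t : asc z t (k *: x + y) = k *: asc z t x + asc z t y.
Proof.
rewrite !asc_def (omulDZr k t x y) (omulDZr k (z ** t) x y) (omulDZr k z (t ** x)).
move: (_ ** _ ** _) (_ ** _ ** _) (_ ** (_ ** _)) (_ ** (_ ** _)) => p q r s.
by rewrite opprD scalerBr addrACA.
Qed.

Lemma ore0 : ore 0 = 0 :> F. Proof. by rewrite oct0 octRe. Qed.
Lemma ore1 : ore one = 1 :> F. Proof. octring. Qed.
Lemma dot_ore x : dot x one = ore x. Proof. octring. Qed.
Lemma omul1l x : one ** x = x. Proof. octring. Qed.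
Lemma omul1r x : x ** one = x. Proof. octring. Qed.

(** Polarisation of [x (x^* t) = dot x x t]. *)
Lemma oconj_omul_polar x y t :
  x ** (Oconj y ** t) + y ** (Oconj x ** t) = (dot x y *+ 2) *: t.
Proof. octring. Qed.

Lemma oconj_add x : Oconj x + x = (ore x *+ 2) *: one. Proof. octring. Qed.

Lemma omul_oconj x y : (x ** y) ** Oconj y = dot y y *: x.
Proof. octring. Qed.

Lemma oconj_omul x y : Oconj x ** (x ** y) = dot x x *: y.
Proof. octring. Qed.

(** The left alternative law; together with [asc_xyy] it makes the associator alternating. *)
Lemma asc_xxy x y : asc x x y = 0.
Proof. rewrite asc_def oct0; octring. Qed.

Lemma asc_xyy x y : asc x y y = 0.
Proof. rewrite asc_def oct0; octring. Qed.

(** Supplies the skew form whose degeneracy yields fact (3). *)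
Lemma asc_skew x y u v : dot (asc x y u) v = - dot (asc x y v) u.
Proof. rewrite !asc_def; octring. Qed.

(** A Moufang-type identity: the vanishing of [[x, y, z]] passes to [[x, x y, z]]. *)
Lemma asc_omul x y z : asc x (x ** y) z = asc x y z ** x.
Proof. rewrite !asc_def; octring. Qed.

Lemma ore_cross x y : ore (cross x y) = 0.
Proof. by rewrite !cross_def; octring. Qed.

(** Coordinates with scalar part set to zero, which keeps the polynomials for imaginary elements
    short. *)
Variant im_spec : 'rV[F]_8 -> Prop :=
  ImSpec b c d e f g h : im_spec (oct 0 b c d e f g h).

Lemma imP x : ore x = 0 -> im_spec x.
Proof. by case: (octP x) => a b c d e f g h; rewrite octRe => ->. Qed.

Lemma octX (b c d e f g h b' c' d' e' f' g' h' : F) :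
  cross (oct 0 b c d e f g h) (oct 0 b' c' d' e' f' g' h') =
  oct 0
   (be * c * d' - be * d * c' - ga * f * e' + ga * e * f'
     + be * ga * g * h' - be * ga * h * g')
   (al * d * b' - al * b * d' - ga * g * e' + al * ga * h * f'
     + ga * e * g' - al * ga * f * h')
   (c * b' - b * c' - ga * h * e' + ga * g * f' + ga * e * h' - ga * f * g')
   (al * f * b' - al * b * f' - be * c * g' + al * be * d * h'
     + be * g * c' - al * be * h * d')
   (e * b' - b * e' + be * d * g' - be * c * h' - be * g * d' + be * h * c')
   (e * c' - c * e' + al * b * h' - al * d * f' - al * h * b' + al * f * d')
   (b * g' - d * e' - c * f' - g * b' + e * d' + f * c').
Proof. by rewrite !cross_def; octring. Qed.

Ltac ims := repeat match goal with H : ore ?x = 0 |- _ => case: _ / (imP H) => {x H} * end.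
Ltac octXs := repeat match goal with
  |- context [cross (oct 0 ?b ?c ?d ?e ?f ?g ?h) (oct 0 ?b' ?c' ?d' ?e' ?f' ?g' ?h')] =>
    oct_rewrite (cross (oct 0 b c d e f g h) (oct 0 b' c' d' e' f' g' h'))
      (octX b c d e f g h b' c' d' e' f' g' h') end.
Ltac imring := intros; ims; octXs; octsimpl; try (congr oct); ring.

Lemma ore_omul_im x y : ore x = 0 -> ore y = 0 -> ore (x ** y) = - dot x y.
Proof. imring. Qed.

Lemma crossC x y : ore x = 0 -> ore y = 0 -> cross x y = - cross y x.
Proof. imring. Qed.

Lemma dot_cross x y z : ore x = 0 -> ore y = 0 -> ore z = 0 ->
  dot (cross x y) z = dot x (cross y z).
Proof. imring. Qed.

(** The left alternative law [x (x y) = (x x) y], expressed by [cross] and [dot]. *)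
Lemma cross_cross x y : ore x = 0 -> ore y = 0 ->
  cross x (cross x y) = dot x y *: x - dot x x *: y.
Proof. imring. Qed.

(** Up to the factor 2, the associator measures the failure of the triple product rule of classical
    vector algebra. *)
Lemma asc_cross x y z : ore x = 0 -> ore y = 0 -> ore z = 0 ->
  asc x y z = 2 *: (dot x z *: y - dot x y *: z - cross x (cross y z)).
Proof. rewrite asc_def; imring. Qed.

Lemma omul_im x y : ore x = 0 -> ore y = 0 ->
  x ** y = cross x y - dot x y *: one.
Proof. by move=> x0 y0; rewrite cross_def ore_omul_im // scaleNr opprK addrK. Qed.

Lemma crossxx x : ore x = 0 -> cross x x = 0.
Proof. move=> x0; rewrite [RHS]oct0; imring. Qed.

Lemma oconj_addZ k x : ore x = 0 -> Oconj (x + k *: one) = k *: one - x.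
Proof. imring. Qed.

End Identities.

(* Abstracting the products keeps [mxE] and [ring] from unfolding them. *)
Ltac vgen := repeat match goal with
  | |- context [Omul ?a ?b ?c ?x ?y] => generalize (Omul a b c x y); intro
  | |- context [cross ?a ?b ?c ?x ?y] => generalize (cross a b c x y); intro
  | |- context [dot ?a ?b ?c ?x ?y] => generalize (dot a b c x y); intro
  | |- context [Oone ?f] => generalize (Oone f); intro end.
Ltac vring := vgen; apply/rowP => ?; rewrite !mxE; ring.

Section Cayley.
Variables (F : fieldType) (al be ga : F).
Hypotheses (two_neq0 : (2%:R : F) != 0) (al0 : al != 0) (be0 : be != 0) (ga0 : ga != 0).
Implicit Types (k : F) (x y z t u v w : 'rV[F]_8) (S T : {vspace 'rV[F]_8}).

Local Notation "x ** y" := (Omul al be ga x y) (at level 40, left associativity).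
Local Notation one := (Oone F).
Local Notation dot := (dot al be ga).
Local Notation cross := (cross al be ga).
Local Notation asc := (asc al be ga).
Local Notation V := (Oim F).

(** * The imaginary space and its dimension *)

Lemma omul0l x : 0 ** x = 0.
Proof.
by have := omulDZl al be ga (-1) 0 0 x; rewrite scaler0 addr0 scaleN1r addNr.
Qed.

Lemma omul0r x : x ** 0 = 0.
Proof.
by have := omulDZr al be ga (-1) x 0 0; rewrite scaler0 addr0 scaleN1r addNr.
Qed.

Lemma one_neq0 : one != 0.
Proof.
by apply/eqP => /(congr1 (@ore F))/eqP; rewrite ore1 ore0 oner_eq0.
Qed.

Lemma mem_im x : (x \in V) = (ore x == 0).
Proof.
rewrite memv_ker linfunE; last first.
  by move=> k u v; rewrite oconjDZ scalerDr addrACA.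
rewrite oconj_add scaler_eq0 (negPf one_neq0) orbF -mulr_natr mulf_eq0.
by rewrite (negPf two_neq0) orbF.
Qed.

Lemma imI x : x \in V -> ore x = 0.
Proof. by rewrite mem_im => /eqP. Qed.

Lemma cross_mem x y : cross x y \in V.
Proof. by rewrite mem_im ore_cross. Qed.

Lemma im_part_mem x : x - ore x *: one \in V.
Proof. by rewrite mem_im addrC -scaleNr oreDZ ore1 mulr1 addNr. Qed.

Lemma oreZ k x : ore (k *: x) = k * ore x.
Proof. by rewrite -[k *: x]addr0 oreDZ ore0 addr0. Qed.

Lemma dim_add_one S : (S <= V)%VS -> \dim (<[one]> + S) = (\dim S).+1.
Proof.
move=> sSV; rewrite dimv_disjoint_sum ?dim_vline ?one_neq0 //.
apply/eqP; rewrite -subv0; apply/subvP => x; rewrite memv_cap.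
case/andP=> /vlineP[k ->] /(subvP sSV)/imI.
by rewrite oreZ ore1 mulr1 => ->; rewrite scale0r mem0v.
Qed.

Lemma add_one_im : (<[one]> + V = fullv)%VS.
Proof.
apply/eqP; rewrite eqEsubv subvf; apply/subvP => x _.
rewrite -(subrK (ore x *: one) x) addrC.
by rewrite memv_add ?im_part_mem // memvZ ?memv_line.
Qed.

Lemma dim_im : \dim V = 7%N.
Proof.
by apply/eqP; rewrite -eqSS -dim_add_one // add_one_im dimvf.
Qed.

(** * Nondegeneracy of [dot], dual families and null triples *)

(** By [octB] the Gram matrix of [dot] in the coordinate basis is diagonal; the vector representing
    a functional has as coordinates its values on that basis divided by the diagonal entries. *)
Definition riesz (f : 'rV[F]_8 -> F^o) : 'rV[F]_8 :=
  oct (f (oct 1 0 0 0 0 0 0 0)) (- al^-1 * f (oct 0 1 0 0 0 0 0 0))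
    (- be^-1 * f (oct 0 0 1 0 0 0 0 0)) ((al * be)^-1 * f (oct 0 0 0 1 0 0 0 0))
    (- ga^-1 * f (oct 0 0 0 0 1 0 0 0)) ((al * ga)^-1 * f (oct 0 0 0 0 0 1 0 0))
    ((be * ga)^-1 * f (oct 0 0 0 0 0 0 1 0))
    (- (al * be * ga)^-1 * f (oct 0 0 0 0 0 0 0 1)).

Lemma rieszP (f : 'rV[F]_8 -> F^o) : linear f -> forall x, dot (riesz f) x = f x.
Proof.
move=> lf x; case: (octP x) => a b c d e g h i.
have -> : oct a b c d e g h i =
    a *: oct 1 0 0 0 0 0 0 0 + (b *: oct 0 1 0 0 0 0 0 0 + (c *: oct 0 0 1 0 0 0 0 0
  + (d *: oct 0 0 0 1 0 0 0 0 + (e *: oct 0 0 0 0 1 0 0 0 + (g *: oct 0 0 0 0 0 1 0 0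
  + (h *: oct 0 0 0 0 0 0 1 0 + i *: oct 0 0 0 0 0 0 0 1)))))).
  by rewrite !octZ !octD; congr oct; ring.
rewrite !lf -[i *: _]addr0 lf.
have -> : f 0 = 0 by have := lf (-1) 0 0; rewrite scaler0 addr0 scaleN1r addNr.
rewrite !dotE /riesz !octB addr0 /GRing.scale /=.
by field; rewrite al0 be0 ga0.
Qed.

Lemma dual_basis n (X : n.-tuple 'rV[F]_8) : free X ->
  forall i j : 'I_n, dot (riesz (coord X i : _ -> F^o)) X`_j = (j == i)%:R.
Proof.
move=> fX i j; rewrite rieszP; first exact: coord_free.
by move=> k x y; rewrite linearP.
Qed.

Lemma dot_nondeg x : (forall y, dot x y = 0) -> x = 0.
Proof.
move=> x0; apply/eqP; apply/negPn/negP => nx.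
have fx : free [tuple x] by rewrite seq1_free.
have := dual_basis fx 0 0.
by rewrite eqxx dotC x0 => /eqP; rewrite eq_sym oner_eq0.
Qed.

(* If [v_i] is the [dot]-dual family of [X], then [x_k (v_i^* x_j) = 2 d_ik x_j],
   so the nine products [v_i^* x_j] would be independent in an 8-dimensional space. *)
Lemma null_triple (X : 3.-tuple 'rV[F]_8) : free X ->
  ~ (forall i j : 'I_3, Oconj X`_i ** X`_j = 0).
Proof.
move=> fX X0; pose v i := riesz (coord X i : _ -> F^o).
pose f (C : 'M[F]_3) : 'rV[F]_8 := \sum_i \sum_j C i j *: (Oconj (v i) ** X`_j).
have lf : linear f.
  move=> k C D; rewrite /f scaler_sumr -big_split; apply: eq_bigr => i _ /=.
  rewrite scaler_sumr -big_split; apply: eq_bigr => j _ /=.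
  by rewrite !mxE scalerDl scalerA.
have lm x : linear (Omul al be ga x) by move=> k y z; apply: omulDZr.
have Xf (k : 'I_3) C : X`_k ** f C = \sum_(j < 3) (C k j *+ 2) *: X`_j.
  rewrite -linfunE // linear_sum (bigD1 k) //= [X in _ + X]big1 ?addr0.
    rewrite linear_sum; apply: eq_bigr => j _; rewrite linearZ /= linfunE //.
    have := oconj_omul_polar al be ga X`_k (v k) X`_j.
    rewrite X0 omul0r addr0 dotC dual_basis // eqxx => ->.
    by rewrite scalerA mulrnAr mulr1.
  move=> i nik; rewrite linear_sum big1 // => j _; rewrite linearZ /= linfunE //.
  have := oconj_omul_polar al be ga X`_k (v i) X`_j.
  rewrite X0 omul0r addr0 dotC dual_basis // eq_sym (negPf nik) mul0rn scale0r => ->.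
  by rewrite scaler0.
have kf0 : lker (linfun f) == 0%VS.
  rewrite -subv0; apply/subvP => C; rewrite memv_ker linfunE // => /eqP fC.
  rewrite memv0; apply/eqP/matrixP => k j; rewrite mxE.
  have := Xf k C; rewrite fC omul0r => /esym e.
  have/freeP/(_ _ e j)/eqP := fX.
  by rewrite -mulr_natr mulf_eq0 (negPf two_neq0) orbF => /eqP.
have := limg_ker_dim (linfun f) fullv; rewrite (eqP kf0) capv0 dimv0 add0n => d9.
have := dimvS (subvf (limg (linfun f))); by rewrite d9 !dimvf.
Qed.

(** * Spans and bases of two or three vectors *)

Lemma free3P x y z : reflect
  (forall a b c : F, a *: x + b *: y + c *: z = 0 -> [/\ a = 0, b = 0 & c = 0])
  (free [:: x; y; z]).
Proof.
rewrite -[[:: x; y; z]]/(tval [tuple x; y; z]); apply: (iffP freeP) => [f3 a b c e | f3 k].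
  have := f3 (fun i : 'I_3 => [:: a; b; c]`_i).
  rewrite !big_ord_recl big_ord0 /= addr0 addrA => /(_ e) h.
  by split; [have := h 0 | have := h 1 | have := h 2%:R].
rewrite !big_ord_recl big_ord0 /= addr0 addrA => /f3[a0 b0 c0] i.
case: i => [[|[|[|//]]] lti]; [rewrite -a0|rewrite -b0|rewrite -c0];
  by congr (k _); apply: val_inj.
Qed.

Lemma span2P v x y : v \in <<[:: x; y]>>%VS -> exists a b, v = a *: x + b *: y.
Proof.
rewrite span_cons span_seq1 => /memv_addP[_ /vlineP[a ->] [_ /vlineP[b ->] ->]].
by exists a, b.
Qed.

Lemma span3P v x y z : v \in <<[:: x; y; z]>>%VS ->
  exists a b c, v = a *: x + b *: y + c *: z.
Proof.
rewrite span_cons => /memv_addP[_ /vlineP[a ->] [w /span2P[b [c ->]] ->]].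
by exists a, b, c; rewrite addrA.
Qed.

Lemma dim3P S : \dim S = 3 ->
  exists x y z, S = <<[:: x; y; z]>>%VS /\ free [:: x; y; z].
Proof.
move=> dS; move: (vbasis S) (vbasisP S); rewrite dS => X /andP[/eqP sX fX].
move: sX fX; case/tupleP: X => x X; case/tupleP: X => y X; case/tupleP: X => z X.
by rewrite tuple0 /= => <-; exists x, y, z.
Qed.

Lemma dim2P S : \dim S = 2 -> exists x y, S = <<[:: x; y]>>%VS /\ free [:: x; y].
Proof.
move=> dS; move: (vbasis S) (vbasisP S); rewrite dS => X /andP[/eqP sX fX].
move: sX fX; case/tupleP: X => x X; case/tupleP: X => y X.
by rewrite tuple0 /= => <-; exists x, y.
Qed.

(** * Pairs whose cross product leaves their span *)

(** The product is [(l - x) (y + m)]; the first equation cancels its imaginary part and the second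
    its scalar part. *)
Lemma omul_null (l m : F) x y : x \in V -> y \in V ->
  cross x y = l *: y - m *: x -> dot x y = - (l * m) ->
  Oconj (x + l *: one) ** (y + m *: one) = 0.
Proof.
move=> /imI x0 /imI y0 cxy dxy; rewrite oconj_addZ //.
rewrite (omulDZl al be ga l one (- x)) omul1l -(scaleN1r x) -[_ *: x]addr0.
rewrite (omulDZl al be ga (-1) x 0) omul0l (addrC y) (omulDZr al be ga m x one y).
rewrite omul1r omul_im // cxy dxy.
vring.
Qed.

Lemma notin_span2 x y w : free [:: x; y] ->
  (w \notin <<[:: x; y]>>%VS) = free [:: w; x; y].
Proof. by move=> fxy; rewrite free_cons fxy andbT. Qed.

Lemma mem_or_not v S : v \in S \/ v \notin S.
Proof. by case: (v \in S); [left | right]. Qed.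

Lemma cross_pair_exists S : (S <= V)%VS -> \dim S = 3 ->
  exists x y, [/\ x \in S, y \in S & cross x y \notin <<[:: x; y]>>%VS].
Proof.
move=> sSV /dim3P[x [y [z [defS /free3P f3]]]].
have [Sx Sy Sz] : [/\ x \in S, y \in S & z \in S].
  by rewrite defS; split; apply: memv_span; rewrite !inE eqxx ?orbT.
have [Vx Vy Vz] : [/\ x \in V, y \in V & z \in V] by split; apply: (subvP sSV).
have [x0 y0 z0] : [/\ ore x = 0, ore y = 0 & ore z = 0] by split; apply: imI.
have pair p q : p \in S -> q \in S ->
    (exists x y, [/\ x \in S, y \in S & cross x y \notin <<[:: x; y]>>%VS]) \/
    exists a b, cross p q = a *: p + b *: q.
  move=> Sp Sq; case: (mem_or_not (cross p q) <<[:: p; q]>>%VS) => [/span2P ?|npq].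
    by right.
  by left; exists p, q; split; [exact: Sp | exact: Sq | exact: npq].
have [//|[a [b cxy]]] := pair _ _ Sx Sy.
have [//|[c [d cxz]]] := pair _ _ Sx Sz.
have [//|[e [f cyz]]] := pair _ _ Sy Sz.
(* The three sums link the coefficients found for different pairs. Comparing them leaves a single
   linear form [l], with [l(x) = b], [l(y) = -a], [l(z) = -c], such that
   [cross p q = l(p) q - l(q) p]. *)
have [//|[a1 [b1]]] := pair _ _ Sx (memvD Sy Sz).
have [//|[a2 [b2]]] := pair _ _ Sy (memvD Sx Sz).
have [//|[a3 [b3]]] := pair _ _ Sz (memvD Sx Sy).
have cyx : cross y x = - (a *: x + b *: y) by rewrite crossC // cxy.
have czx : cross z x = - (c *: x + d *: z) by rewrite crossC // cxz.
have czy : cross z y = - (e *: y + f *: z) by rewrite crossC // cyz.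
rewrite !crossDr cyx cxy cxz cyz czx czy => e3 e2 e1.
have lin (p q : 'rV[F]_8) (a' b' c' : F) :
    p = q -> p - q = a' *: x + b' *: y + c' *: z -> [/\ a' = 0, b' = 0 & c' = 0].
  by move=> -> /esym; rewrite subrr => /f3.
have [_ /eqP bb1 /eqP db1] : [/\ a + c - a1 = 0, b - b1 = 0 & d - b1 = 0].
  by apply: lin e1 _; vring.
have [/eqP ab2 _ /eqP fb2] : [/\ - a - b2 = 0, - b + e - a2 = 0 & f - b2 = 0].
  by apply: lin e2 _; vring.
have [/eqP cb3 /eqP eb3 _] : [/\ - c - b3 = 0, - e - b3 = 0 & - d - f - a3 = 0].
  by apply: lin e3 _; vring.
move: bb1 db1 ab2 fb2 cb3 eb3; rewrite !subr_eq0.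
move=> /eqP bb1 /eqP db1 /eqP ab2 /eqP fb2 /eqP cb3 /eqP eb3.
have {db1 bb1} db : d = b by rewrite db1 -bb1.
have {fb2 ab2} fa : f = - a by rewrite fb2 -ab2.
have {eb3 cb3} ec : e = c by apply: oppr_inj; rewrite eb3 -cb3.
rewrite {}db {}fa {}ec in cxz cyz cyx czx czy * => {e1 e2 e3}.
(* Inserting the form [l] into [cross_cross] gives [dot p q = - l(p) l(q)] on all pairs of basis
   vectors. *)
have [/eqP dxy /eqP dxx _] : [/\ a * b - dot x y = 0, b * b + dot x x = 0 & 0 = 0 :> F].
  apply: lin (cross_cross al be ga x0 y0) _; rewrite cxy !crossE crossxx // cxy; vring.
have [/eqP dxz _ _] : [/\ b * c - dot x z = 0, 0 = 0 :> F & b * b + dot x x = 0].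
  apply: lin (cross_cross al be ga x0 z0) _; rewrite cxz !crossE crossxx // cxz; vring.
have [_ /eqP dyz /eqP dyy] : [/\ 0 = 0 :> F, - (a * c) - dot y z = 0 & a * a + dot y y = 0].
  apply: lin (cross_cross al be ga y0 z0) _; rewrite cyz !crossE crossxx // cyz; vring.
have [/eqP dzz _ _] : [/\ c * c + dot z z = 0, 0 = 0 :> F & b * c - dot z x = 0].
  apply: lin (cross_cross al be ga z0 x0) _; rewrite czx !crossE crossxx // czx; vring.
exfalso.
(* These are the vectors [v + l(v)] for [v] among [x, y, z]; by [omul_null] all products [u^* v] of
   two of them vanish. *)
pose X := [tuple x + b *: one; y + (- a) *: one; z + (- c) *: one].
apply: (@null_triple X).
  apply/free3P => p q r /= e0.
  have e1 : p *: x + q *: y + r *: z + (p * b - q * a - r * c) *: one = 0.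
    by rewrite -e0; vring.
  (* Since [x, y, z] are imaginary, the scalar part of the relation is exactly this coefficient. *)
  have s0 : p * b - q * a - r * c = 0.
    have := congr1 (@ore F) e1; rewrite addrC oreDZ ore1 -!addrA !oreDZ oreZ.
    by rewrite x0 y0 z0 ore0 !mulr0 !addr0 mulr1.
  by apply: f3; rewrite s0 scale0r addr0 in e1.
move: dxy dxx dxz dyz dyy dzz; rewrite !subr_eq0 !addr_eq0.
move=> /eqP/esym dxy /eqP dxx /eqP/esym dxz /eqP/esym dyz /eqP dyy /eqP dzz.
have {dxx dyy dzz} [dxx dyy dzz] :
    [/\ dot x x = - (b * b), dot y y = - (a * a) & dot z z = - (c * c)].
  by rewrite dxx dyy dzz !opprK.
have [dyx dzx dzy] : [/\ dot y x = a * b, dot z x = b * c & dot z y = - (a * c)].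
  by rewrite ![dot _ x]dotC (dotC _ _ _ z y) dxy dxz dyz.
case=> [[|[|[|//]]] ?] [[|[|[|//]]] ?] /=.
- by apply: (omul_null Vx Vx); [rewrite crossxx // subrr | rewrite dxx].
- by apply: (omul_null Vx Vy); [rewrite cxy; vring | rewrite dxy; ring].
- by apply: (omul_null Vx Vz); [rewrite cxz; vring | rewrite dxz; ring].
- by apply: (omul_null Vy Vx); [rewrite cyx; vring | rewrite dyx; ring].
- by apply: (omul_null Vy Vy); [rewrite crossxx // subrr | rewrite dyy; ring].
- by apply: (omul_null Vy Vz); [rewrite cyz; vring | rewrite dyz; ring].
- by apply: (omul_null Vz Vx); [rewrite czx; vring | rewrite dzx; ring].
- by apply: (omul_null Vz Vy); [rewrite czy; vring | rewrite dzy; ring].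
- by apply: (omul_null Vz Vz); [rewrite crossxx // subrr | rewrite dzz; ring].
Qed.

(** * The alternating associator and orthogonality relations *)

(** Linearisation of the left alternative law at [x + y]; the coefficient 1 only gives the sum the
    shape that [ascDZ1] and [ascDZ2] expect. *)
Lemma ascC12 x y z : asc y x z = - asc x y z.
Proof.
have := asc_xxy al be ga (1 *: x + y) z; rewrite ascDZ1 !ascDZ2 !asc_xxy !scale1r.
by rewrite add0r addr0 addrC => /eqP; rewrite addr_eq0 => /eqP.
Qed.

Lemma ascC23 x y z : asc x z y = - asc x y z.
Proof.
have := asc_xyy al be ga x (1 *: y + z); rewrite ascDZ2 !ascDZ3 !asc_xyy !scale1r.
by rewrite add0r addr0 addrC => /eqP; rewrite addr_eq0 => /eqP.
Qed.

Lemma asc_xyx x y : asc x y x = 0.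
Proof. by rewrite ascC23 asc_xxy oppr0. Qed.

Lemma asc_one x y : asc x y one = 0.
Proof. by rewrite asc_def !omul1r subrr. Qed.

Lemma asc0_cross x y z : x \in V -> y \in V -> z \in V -> asc x y z = 0 ->
  cross x (cross y z) = dot x z *: y - dot x y *: z.
Proof.
move=> /imI x0 /imI y0 /imI z0; rewrite asc_cross // => /eqP.
by rewrite scaler_eq0 (negPf two_neq0) subr_eq0 /= => /eqP.
Qed.

Lemma asc0_rot x y z : asc x y z = 0 -> asc z x y = 0.
Proof. by move=> a0; rewrite ascC12 ascC23 a0 !oppr0. Qed.

(** [cross x y] differs from [x y] by a multiple of the unit, which has zero associators, and
    [asc_omul] handles [x y]. *)
Lemma asc0_crossr x y z : x \in V -> y \in V -> asc x y z = 0 ->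
  asc x (cross x y) z = 0.
Proof.
move=> /imI x0 /imI y0 a0.
have -> : cross x y = dot x y *: one + x ** y.
  by rewrite (omul_im al be ga x0 y0) addrC subrK.
rewrite ascDZ2 asc_omul a0 omul0l addr0 ascC23 asc_one.
by rewrite oppr0 scaler0.
Qed.

(** Lagrange's identity: the norm of [cross x y] is the Gram determinant of [x] and [y], so its
    vanishing means that [dot] degenerates on their span. *)
Lemma dot_cross_cross x y : x \in V -> y \in V ->
  dot (cross x y) (cross x y) = dot x x * dot y y - dot x y ^+ 2.
Proof.
move=> /imI x0 /imI y0; rewrite dot_cross ?ore_cross // (crossC _ _ _ x0 y0) crossNr.
by rewrite cross_cross // !dotE (dotC _ _ _ y x); ring.
Qed.

Lemma dot_cross_l x y : x \in V -> y \in V -> dot x (cross x y) = 0.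
Proof. by move=> /imI x0 /imI y0; rewrite -dot_cross // crossxx // dot0l. Qed.

Lemma dot_cross_r x y : x \in V -> y \in V -> dot y (cross x y) = 0.
Proof.
by move=> Vx Vy; rewrite (crossC _ _ _ (imI Vx) (imI Vy)) dotNr dot_cross_l ?oppr0.
Qed.

Lemma mem_span2 x y (a b : F) : a *: x + b *: y \in <<[:: x; y]>>%VS.
Proof. by apply: memvD; apply: memvZ; apply: memv_span; rewrite !inE eqxx ?orbT. Qed.

Lemma mem_span3 x y z (a b c : F) : a *: x + b *: y + c *: z \in <<[:: x; y; z]>>%VS.
Proof.
by do 2?apply: memvD; apply: memvZ; apply: memv_span; rewrite !inE eqxx ?orbT.
Qed.

Lemma free_cross x y : y \in V -> cross x y \notin <<[:: x; y]>>%VS -> free [:: x; y].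
Proof.
move=> Vy; apply: contraR; rewrite free_cons seq1_free negb_and !negbK span_seq1.
case/orP=> [/vlineP[k ->] | /eqP ->]; last by rewrite cross0r mem0v.
by rewrite crossZl crossxx ?imI // scaler0 mem0v.
Qed.

(** Otherwise [cross] would vanish on a 3-dimensional subspace of [V], against
    [cross_pair_exists]. *)
Lemma cross0_dep x y z : x \in V -> y \in V -> z \in V ->
  cross x y = 0 -> cross x z = 0 -> cross y z = 0 -> ~~ free [:: x; y; z].
Proof.
move=> Vx Vy Vz cxy cxz cyz; apply/negP => f3.
have sV : (<<[:: x; y; z]>> <= V)%VS.
  by apply/span_subvP => u; rewrite !inE => /or3P[] /eqP ->.
have d3 : \dim <<[:: x; y; z]>>%VS = 3 by rewrite (eqnP f3).
have [p [q [/span3P[a [b [c ->]]] /span3P[a' [b' [c' ->]]]]]] := cross_pair_exists sV d3.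
case/negP; have [x0 y0 z0] := And3 (imI Vx) (imI Vy) (imI Vz).
rewrite !crossDl !crossDr !crossZl !crossZr !crossxx //.
rewrite (crossC _ _ _ y0 x0) (crossC _ _ _ z0 x0) (crossC _ _ _ z0 y0).
by rewrite cxy cxz cyz oppr0 !scaler0 !addr0 mem0v.
Qed.

Lemma dot_sum n (r : 'I_n -> F) (v : 'I_n -> 'rV[F]_8) x :
  dot (\sum_i r i *: v i) x = \sum_i r i * dot (v i) x.
Proof.
rewrite (big_morph (fun u => dot u x) (id1 := 0) (op1 := +%R)) ?dot0l //.
  by apply: eq_bigr => i _; rewrite dotZl.
by move=> u u'; rewrite dotDl.
Qed.

(** Pairing with four independent vectors is a map of rank 4 on an 8-dimensional space, so its
    kernel has dimension 4. If the vectors were imaginary and totally isotropic, that kernel would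
    contain them and the unit, hence 5 dimensions. *)
Lemma isotropic_dep (X : 4.-tuple 'rV[F]_8) : {subset X <= V} ->
  {in X &, forall u v, dot u v = 0} -> ~~ free X.
Proof.
move=> sXV X0; apply/negP => fX.
pose f (t : 'rV[F]_8) : 'rV[F]_4 := \row_i dot t X`_i.
have lf : linear f.
  by move=> k u v; apply/rowP => i; rewrite !mxE dotDl dotZl.
(* Surjectivity: the [dot]-dual family of [X] is sent to the standard basis. *)
have imf : limg (linfun f) = fullv.
  apply/eqP; rewrite eqEsubv subvf; apply/subvP => r _.
  have -> : r = linfun f (\sum_i r 0 i *: riesz (coord X i : _ -> F^o)).
    rewrite linfunE //; apply/rowP => j; rewrite mxE dot_sum (bigD1 j) //=.
    rewrite dual_basis // eqxx mulr1 big1 ?addr0 // => i nij.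
    by rewrite dual_basis // eq_sym (negPf nij) mulr0.
  exact: memv_img (memvf _).
have kf : (<[one]> + <<X>> <= lker (linfun f))%VS.
  rewrite subv_add; apply/andP; split.
    apply/subvP => _ /vlineP[k ->]; rewrite memv_ker linfunE //.
    apply/eqP/rowP => j; rewrite !mxE dotZl dotC dot_ore (imI (sXV _ _)) ?mulr0 //.
    by rewrite mem_nth ?size_tuple.
  apply/span_subvP => u Xu; rewrite memv_ker linfunE //; apply/eqP/rowP => j.
  by rewrite !mxE X0 // mem_nth ?size_tuple.
have := limg_ker_dim (linfun f) fullv; rewrite capfv imf !dimvf /= => d8.
have := dimvS kf; rewrite dim_add_one; last by apply/span_subvP.
have -> : \dim <<X>> = 4 by rewrite (eqnP fX) size_tuple.
by rewrite -(leq_add2r 4) d8.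
Qed.

(** * The kernel of the associator of a pair *)

(** The normalised case in which [dot] has rank 1 on [<x, y>]. All cross products among [z], [y] and
    [w] turn out to be zero, so [cross0_dep] makes these three dependent, while [y] and [w] are
    independent. *)
Lemma asc_kernel_rank1 x y z : x \in V -> y \in V -> z \in V ->
  cross x y \notin <<[:: x; y]>>%VS -> asc x y z = 0 ->
  dot x x != 0 -> dot y y = 0 -> dot x y = 0 -> dot z x = 0 ->
  z \in <<[:: y; cross x y]>>%VS.
Proof.
move=> Vx Vy Vz nw a0 nx0 dyy dxy dzx; set w := cross x y.
have [[x0 y0 z0] Vw] := (And3 (imI Vx) (imI Vy) (imI Vz), cross_mem x y : w \in V).
have /free3P f3 : free [:: w; x; y] by rewrite -notin_span2 ?(free_cross Vy nw).
have cxw : cross x w = - dot x x *: y by rewrite cross_cross // dxy scale0r add0r scaleNr.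
have cyw : cross y w = 0.
  by rewrite /w (crossC _ _ _ x0 y0) crossNr cross_cross // dotC dxy dyy !scale0r subr0 oppr0.
have czw : cross z w = dot z y *: x.
  by rewrite asc0_cross ?(asc0_rot a0) // dzx scale0r subr0.
have czy : cross z y = - (dot z w / dot x x) *: x.
  have := asc0_cross Vz Vx Vw (asc0_rot (asc0_crossr Vx Vy a0)).
  rewrite cxw crossZr dzx scale0r subr0 => e.
  apply: (scalerI (_ : - dot x x != 0)); first by rewrite oppr_eq0.
  by rewrite e scalerA mulrN mulNr opprK mulrCA divff ?mulr1.
(* [cross y (cross y z)] is a multiple of [w] by the formula for [cross z y], and a multiple of [y]
   by [cross_cross]; both coefficients must vanish. *)
have [d1 _ d2] : [/\ dot z w / dot x x = 0, 0 = 0 :> F & dot y z = 0].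
  apply: f3; have := cross_cross al be ga y0 z0.
  rewrite (crossC _ _ _ y0 z0) czy -scaleNr opprK crossZr (crossC _ _ _ y0 x0) -/w.
  rewrite dyy scale0r subr0.
  move=> /esym ->; rewrite scale0r addr0; vring.
have {d1} d1 : dot z w = 0.
  by move/eqP: d1; rewrite mulf_eq0 invr_eq0 (negPf nx0) orbF => /eqP.
have := cross0_dep Vz Vy Vw _ _ cyw.
rewrite czy czw d1 mul0r (dotC _ _ _ z y) d2 oppr0 !scale0r => /(_ erefl erefl).
rewrite free_cons negb_and negbK => /orP[//|]; rewrite free_cons seq1_free.
have -> : w != 0 by apply: contraNneq nw => e; rewrite -/w e mem0v.
rewrite andbT negbK span_seq1 => /vlineP[k ey].
have [] := f3 (- k) 0 1; last by move=> _ _ /eqP; rewrite oner_eq0.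
by rewrite {1}ey scale0r addr0 scale1r scaleNr addNr.
Qed.

(** Gram-Schmidt against [x] changes neither [cross x y] nor the associator. It makes [y] isotropic,
    because the Gram determinant is zero, and thus reduces to [asc_kernel_rank1]. *)
Lemma asc_kernel_degenerate x y z : x \in V -> y \in V -> z \in V ->
  cross x y \notin <<[:: x; y]>>%VS -> asc x y z = 0 ->
  dot x x != 0 -> dot (cross x y) (cross x y) = 0 ->
  z \in <<[:: x; y; cross x y]>>%VS.
Proof.
move=> Vx Vy Vz nw a0 nx0; rewrite dot_cross_cross // => /eqP; rewrite subr_eq0 => /eqP nw0.
pose p := dot x y / dot x x; pose q := dot z x / dot x x.
pose y1 := (- p) *: x + y; pose z1 := (- q) *: x + z.
have [Vy1 Vz1] : y1 \in V /\ z1 \in V by rewrite !memvD ?memvZ.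
have ew : cross x y1 = cross x y by rewrite /y1 crossDr crossZr crossxx ?imI // scaler0 add0r.
have : z1 \in <<[:: y1; cross x y1]>>%VS.
  apply: (@asc_kernel_rank1 x) => //.
  - rewrite ew; apply: contra nw => /span2P[a [b ->]].
    rewrite (_ : _ + _ = (a - b * p) *: x + b *: y) ?mem_span2 //.
    by rewrite /y1; vring.
  - by rewrite /y1 ascDZ2 asc_xxy scaler0 add0r /z1 ascDZ3 asc_xyx scaler0 add0r.
  - rewrite /y1 !dotE (dotC _ _ _ y x) /p.
    move: nw0 nx0; move: (dot x x) (dot x y) (dot y y) => a b c e na.
    have -> : c = b ^+ 2 / a by rewrite -e mulrC mulKf.
    by field; apply: na.
  - by rewrite /y1 !dotE /p mulNr divfK // addNr.
  - by rewrite /z1 !dotE /q mulNr divfK // addNr.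
case/span2P => a [b]; rewrite ew => ez.
have -> : z = (q - a * p) *: x + a *: y + b *: cross x y.
  by rewrite -[z](addKr (- q *: x)) -/z1 ez /y1; vring.
exact: mem_span3.
Qed.

Lemma asc_kernel x y z : x \in V -> y \in V -> z \in V ->
  cross x y \notin <<[:: x; y]>>%VS -> asc x y z = 0 ->
  z \in <<[:: x; y; cross x y]>>%VS.
Proof.
move=> Vx Vy Vz nw a0; set w := cross x y.
have [[x0 y0 z0] Vw] := (And3 (imI Vx) (imI Vy) (imI Vz), cross_mem x y : w \in V).
have fwxy : free [:: w; x; y] by rewrite -notin_span2 ?(free_cross Vy nw).
have /free3P f3 := fwxy.
have eyx : cross y x = - w by rewrite crossC.
have cxw : cross x w = dot x y *: x - dot x x *: y by rewrite cross_cross.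
have cyw : cross y w = dot y y *: x - dot x y *: y.
  by rewrite -[w]opprK -eyx crossNr cross_cross // opprB dotC.
have czw : cross z w = dot z y *: x - dot z x *: y by rewrite asc0_cross ?(asc0_rot a0).
(* If [dot w w] is nonzero, [cross w (cross w z) = dot w z w - dot w w z] can be solved for [z], and
   its left side lies in [<x, y>]. *)
have [nw0|nw0] := eqVneq (dot w w) 0; last first.
  have := cross_cross al be ga (imI Vw) z0.
  rewrite (crossC _ _ _ (imI Vw) z0) czw crossNr crossDr crossNr !crossZr.
  rewrite (crossC _ _ _ (imI Vw) x0) (crossC _ _ _ (imI Vw) y0) cxw cyw => e.
  move: e; set E := LHS => e.
  have -> : z = (dot w w)^-1 *: (dot w z *: w - E).
    by rewrite e opprB addrC subrK scalerK.
  rewrite (_ : _ *: _ = ((dot w w)^-1 * (dot z x * dot y y - dot z y * dot x y)) *: x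
     + ((dot w w)^-1 * (dot z y * dot x x - dot z x * dot x y)) *: y
     + ((dot w w)^-1 * dot w z) *: w); first exact: mem_span3.
  by rewrite /E; vring.
have [nx0|nx0] := eqVneq (dot x x) 0; last exact: asc_kernel_degenerate.
(* Exchanging [x] and [y] only changes the sign of [w], so the previous case applies. *)
have [ny0|ny0] := eqVneq (dot y y) 0; last first.
  have : z \in <<[:: y; x; cross y x]>>%VS.
    apply: asc_kernel_degenerate => //; last by rewrite eyx dotNl dotNr opprK.
      rewrite eyx memvN; apply: contra nw => /span2P[a [b e]].
      by rewrite -/w e addrC mem_span2.
    by rewrite ascC12 a0 oppr0.
  case/span3P => a [b [c ->]]; rewrite eyx scalerN -scaleNr (addrC (a *: y)).
  exact: mem_span3.
(* Now [x], [y] and [w] are isotropic. The aim is that [z, w, x, y] are pairwise orthogonal and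
   isotropic, so that [isotropic_dep] makes them dependent. *)
have dxy : dot x y = 0.
  by move/eqP: nw0; rewrite dot_cross_cross // nx0 ny0 mul0r sub0r oppr_eq0 sqrf_eq0 => /eqP.
have [/eqP dzx /eqP dzw _] : [/\ - dot z x = 0, dot z w = 0 & 0 = 0 :> F].
  apply: f3; have := asc0_cross Vz Vx Vw (asc0_rot (asc0_crossr Vx Vy a0)).
  rewrite cxw nx0 dxy !scale0r subr0 cross0r => e.
  by rewrite [RHS]e; vring.
have [/eqP dzy _ _] : [/\ dot z y = 0, 0 = 0 :> F & - dot z w = 0].
  have a1 : asc y x z = 0 by rewrite ascC12 a0 oppr0.
  apply: f3; have := asc0_cross Vz Vy (cross_mem _ _) (asc0_rot (asc0_crossr Vy Vx a1)).
  rewrite eyx crossNr cyw ny0 dxy !scale0r subr0 oppr0 cross0r dotNr => e.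
  by rewrite [RHS]e; vring.
move: dzx dzw dzy; rewrite !oppr_eq0 => /eqP dzx /eqP dzw /eqP dzy.
have dzz : dot z z = 0.
  have := cross_cross al be ga z0 (imI Vw); rewrite czw dzx dzy dzw !scale0r subr0 cross0r sub0r.
  move=> /eqP; rewrite eq_sym oppr_eq0 scaler_eq0 => /orP[/eqP //|/eqP w0].
  by case/negP: nw; rewrite -/w w0 mem0v.
have : ~~ free [tuple z; w; x; y].
  have [dxw dyw] : dot x w = 0 /\ dot y w = 0 by rewrite dot_cross_l ?dot_cross_r.
  apply: isotropic_dep => [u|u v]; first by rewrite !inE => /or4P[] /eqP->.
  rewrite !inE => /or4P[] /eqP-> /or4P[] /eqP->;
    by rewrite ?dzz ?dzw ?dzx ?dzy ?nw0 ?nx0 ?ny0 ?dxy ?dxw ?dyw // dotC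
      ?dzz ?dzw ?dzx ?dzy ?nw0 ?nx0 ?ny0 ?dxy ?dxw ?dyw.
rewrite /= free_cons fwxy andbT negbK => /span3P[a [b [c ->]]].
rewrite -addrA addrC; exact: mem_span3.
Qed.

(** * Blocks as spans, and kernel vectors outside a given plane *)

(** The associator is trilinear and alternating, so on the span it is determined by its value on the
    three generators. *)
Lemma asc_span3 x y z : asc x y z = 0 ->
  {in <<[:: x; y; z]>>%VS & &, forall p q r, asc p q r = 0}.
Proof.
move=> a0.
have [a1 a2] := (asc0_rot a0, asc0_rot (asc0_rot a0)).
have [b0 b1 b2] : [/\ asc y x z = 0, asc x z y = 0 & asc z y x = 0].
  by rewrite ascC12 a0 ascC23 a0 ascC12 a2 !oppr0.
have s0 p q r : p \in [:: x; y; z] -> q \in [:: x; y; z] -> r \in [:: x; y; z] ->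
    asc p q r = 0.
  by rewrite !inE => /or3P[] /eqP-> /or3P[] /eqP-> /or3P[] /eqP->;
    rewrite ?asc_xxy ?asc_xyy ?asc_xyx.
have s1 p q : p \in [:: x; y; z] -> q \in [:: x; y; z] ->
    {in <<[:: x; y; z]>>%VS, forall r, asc p q r = 0}.
  move=> Xp Xq; apply: linear_span0 => [k u v|r Xr]; first exact: ascDZ3.
  exact: s0.
have s2 p r : p \in [:: x; y; z] -> r \in <<[:: x; y; z]>>%VS ->
    {in <<[:: x; y; z]>>%VS, forall q, asc p q r = 0}.
  move=> Xp Xr; apply: linear_span0 => [k u v|q Xq]; first exact: ascDZ2.
  exact: s1.
move=> p q r Sp Sq Sr; move: p Sp.
apply: linear_span0 => [k u v|p Xp]; first exact: ascDZ1.
exact: s2.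
Qed.

Lemma block_asc0 S x y z : assoc_blocks al be ga S ->
  x \in S -> y \in S -> z \in S -> asc x y z = 0.
Proof. by case=> _ _ aS Sx Sy Sz; rewrite asc_def aS // subrr. Qed.

Lemma block_span3 x y z : x \in V -> y \in V -> z \in V -> free [:: x; y; z] ->
  asc x y z = 0 -> assoc_blocks al be ga <<[:: x; y; z]>>%VS.
Proof.
move=> Vx Vy Vz f3 a0; split.
- by apply/span_subvP => u; rewrite !inE => /or3P[] /eqP->.
- by rewrite (eqnP f3).
- move=> p q r Sp Sq Sr; apply/eqP; rewrite -subr_eq0 -asc_def.
  by rewrite (asc_span3 a0).
Qed.

Lemma block_cross S x y : assoc_blocks al be ga S -> x \in S -> y \in S ->
  cross x y \notin <<[:: x; y]>>%VS -> S = <<[:: x; y; cross x y]>>%VS.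
Proof.
move=> bS Sx Sy nw; have [sSV dS _] := bS.
apply/eqP; rewrite eqEdim dS dim_span andbT; apply/subvP => z Sz.
by apply: asc_kernel; rewrite ?(subvP sSV) ?(block_asc0 bS).
Qed.

Lemma asc_cross_self x y : x \in V -> y \in V -> asc x y (cross x y) = 0.
Proof.
by move=> Vx Vy; rewrite ascC23 asc0_crossr ?oppr0 // asc_xyy.
Qed.

(* The form [dot (asc x y u) v] is skew with [1, x, y] in its radical; a
   complement of the radical vectors has odd dimension 5, so the form is
   degenerate there. *)
Lemma asc_kernel_exists x y : x \in V -> y \in V -> free [:: x; y] ->
  exists z, [/\ z \in V, z \notin <<[:: x; y]>>%VS & asc x y z = 0].
Proof.
move=> Vx Vy fxy; set T := <<[:: x; y]>>%VS; pose W := (<[one]> + T)%VS.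
have sTV : (T <= V)%VS by apply/span_subvP => u; rewrite !inE => /orP[] /eqP->.
have dW : \dim W^C = 5 by rewrite dimv_compl dim_add_one // (eqnP fxy) dimvf.
move: (vbasis W^C) (vbasisP W^C); rewrite dW => X /andP[/eqP sX fX].
pose G : 'M[F]_5 := \matrix_(i, j) dot (asc x y X`_i) X`_j.
have G0 : \det G == 0.
  have eG : G^T = -1 *: G.
    by apply/matrixP => i j; rewrite !mxE asc_skew mulN1r.
  have := det_tr G; rewrite eG detZ exprS -signr_odd /= expr0 mulr1 mulN1r => /eqP.
  rewrite eq_sym -subr_eq0 opprK -mulr2n -mulr_natr mulf_eq0 (negPf two_neq0).
  by rewrite orbF.
have [c nc cG] := det0P G0; pose u := \sum_i c 0 i *: X`_i.
have la : linear (asc x y) by move=> k p q; apply: ascDZ3.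
have eu : asc x y u = \sum_i c 0 i *: asc x y X`_i.
  rewrite -(linfunE la) /u linear_sum /=; apply: eq_bigr => i _.
  by rewrite linearZ /= linfunE.
have ld (p : 'rV[F]_8) : linear (dot p : _ -> F^o).
  by move=> k q r; rewrite dotDr dotZr.
have a0 : asc x y u = 0.
  (* Against [W] the vector [asc x y u] vanishes by skewness, and against the complement by the
     choice of [c]. *)
  apply: dot_nondeg => t.
  have /memv_addP[_ /memv_addP[_ /vlineP[k ->] [s Ts ->]] [r Cr ->]] :
    t \in (W + W^C)%VS by rewrite addv_complf memvf.
  rewrite !dotDr dotZr asc_skew asc_one dot0l oppr0 mulr0 add0r.
  have -> : dot (asc x y u) s = 0.
    apply: (linear_span0 (ld _) _ Ts) => q.
    by rewrite !inE => /orP[] /eqP->; rewrite asc_skew ?asc_xyx ?asc_xyy dot0l oppr0.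
  rewrite add0r; rewrite -sX in Cr; apply: (linear_span0 (ld _) _ Cr) => q.
  case/(nthP 0) => j; rewrite size_tuple => ltj <-.
  have := congr1 (fun M : 'rV[F]_5 => M 0 (Ordinal ltj)) cG.
  rewrite !mxE eu dot_sum => {2}<-.
  by apply: eq_bigr => i _; rewrite mxE.
(* If the imaginary part of [u] were in [<x, y>], then [u] would lie in both [W] and its complement,
   hence be zero, although [c] is not. *)
exists (u - ore u *: one); split; first exact: im_part_mem.
  apply/negP => Tz; case/eqP: nc.
  have u0 : u = 0.
    apply/eqP; rewrite -memv0 -(capv_compl W) memv_cap; apply/andP; split.
      by rewrite -(subrK (ore u *: one) u) addrC memv_add // memvZ ?memv_line.
    rewrite -sX; apply: memv_suml => i _.
    by rewrite memvZ // memv_span // mem_nth ?size_tuple.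
  by apply/rowP => i; rewrite mxE; have/freeP := fX; apply.
by rewrite -scaleNr addrC ascDZ3 asc_one scaler0 add0r.
Qed.

(** * Covering and minimality *)

Lemma block_cover : covers V 2 (assoc_blocks al be ga).
Proof.
move=> T sTV /dim2P[x [y [eT fxy]]].
have [Vx Vy] : x \in V /\ y \in V.
  by split; apply: (subvP sTV); rewrite eT memv_span // !inE eqxx ?orbT.
have [z [Vz nz a0]] := asc_kernel_exists Vx Vy fxy.
exists <<[:: z; x; y]>>%VS; split; last by rewrite eT (span_cons z) addvSr.
by apply: block_span3; rewrite ?(asc0_rot a0) // -notin_span2.
Qed.

Lemma block_design :
  q_covering_design V 7 3 2 (assoc_blocks al be ga).
Proof.
by split; [exact: dim_im | move=> S [] | exact: block_cover].
Qed.

Lemma block_minimal : covering_minimal V 2 (assoc_blocks al be ga).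
Proof.
move=> Bl sBl [S [bS nS]] cov; have [sSV dS _] := bS.
have [x [y [Sx Sy nw]]] := cross_pair_exists sSV dS.
have [Vx Vy] := (subvP sSV _ Sx, subvP sSV _ Sy).
have sT : (<<[:: x; y]>> <= S)%VS by apply/span_subvP => u; rewrite !inE => /orP[] /eqP->.
have [|S' [bS' sS']] := cov _ (subv_trans sT sSV).
  by rewrite (eqnP (free_cross Vy nw)).
have [Sx' Sy'] : x \in S' /\ y \in S'.
  by split; apply: (subvP sS'); rewrite memv_span // !inE eqxx ?orbT.
(* Both [S] and the block [S'] covering the plane equal [<x, y, cross x y>]. *)
case: nS; rewrite (block_cross bS Sx Sy nw).
by rewrite -(block_cross (sBl _ bS') Sx' Sy' nw).
Qed.

(** * Uniqueness of blocks and division algebras *)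

Lemma division_anisotropic : division_alg al be ga -> forall x, dot x x = 0 -> x = 0.
Proof.
move=> div x dxx; have := omul_oconj al be ga one x.
rewrite omul1l dxx scale0r => /div[//|c0].
by apply: dot_nondeg => y; rewrite dotC dot_def c0 omul0r ore0.
Qed.

Lemma division_design : division_alg al be ga ->
  subspace_design1 V 7 3 2 (assoc_blocks al be ga).
Proof.
move=> /division_anisotropic aniso; have [dV sub cov] := block_design.
split=> // T sTV dT; have [S [bS sTS]] := cov T sTV dT; exists S; split=> // S' [bS' sTS'].
have [x [y [eT fxy]]] := dim2P dT.
have [Tx Ty] : x \in T /\ y \in T by rewrite eT !memv_span // !inE eqxx ?orbT.
have [Vx Vy] := (subvP sTV _ Tx, subvP sTV _ Ty).
(* [cross x y] is orthogonal to [x] and [y]. Inside their span it would be isotropic, hence zero,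
   and then [cross_cross] would make [x] and [y] dependent. *)
have nw : cross x y \notin <<[:: x; y]>>%VS.
  apply/negP => /span2P[a [b e]].
  have w0 : cross x y = 0.
    apply: aniso; rewrite {1}e dotDl !dotZl dot_cross_l // dot_cross_r //.
    by rewrite !mulr0 addr0.
  have := cross_cross al be ga (imI Vx) (imI Vy); rewrite w0 cross0r => /esym/eqP.
  move: fxy; rewrite free_cons seq1_free span_seq1 => /andP[nx ny].
  rewrite subr_eq0 => /eqP e0; have [dxy|nxy] := eqVneq (dot x y) 0.
    move: e0; rewrite dxy scale0r => /esym/eqP; rewrite scaler_eq0 (negPf ny) orbF.
    by move=> /eqP/aniso x0; rewrite x0 mem0v in nx.
  case/negP: nx; apply/vlineP; exists ((dot x y)^-1 * dot x x).
  by rewrite -scalerA -e0 scalerK.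
rewrite (block_cross bS _ _ nw) ?(subvP sTS) //.
by rewrite -(block_cross bS' _ _ nw) ?(subvP sTS').
Qed.

(** Since [a^* (a t) = 0], the image of left multiplication by [a] lies in the kernel of that by
    [a^*]. By rank-nullity one of the two kernels has dimension at least 4, and [V] has codimension
    1. *)
Lemma null_annihilator a : dot a a = 0 ->
  exists2 b, b = a \/ b = Oconj a & (2 < \dim (lker (linfun (Omul al be ga b)) :&: V))%N.
Proof.
move=> daa; have lm x : linear (Omul al be ga x) by move=> k y z; apply: omulDZr.
have cap (K : {vspace 'rV[F]_8}) : (3 < \dim K)%N -> (2 < \dim (K :&: V))%N.
  move=> dK; have := dimv_sum_cap K V; rewrite dim_im => e.
  have := dimvS (subvf (K + V)%VS); rewrite dimvf -[dim _]/8%N => le8.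
  lia.
have sub : (limg (linfun (Omul al be ga a)) <= lker (linfun (Omul al be ga (Oconj a))))%VS.
  apply/subvP => _ /memv_imgP[t _ ->]; rewrite memv_ker !linfunE //.
  by rewrite oconj_omul daa scale0r.
have := limg_ker_dim (linfun (Omul al be ga a)) fullv; rewrite capfv dimvf -[dim _]/8%N => e8.
have [le|gt] := leqP 4 (\dim (lker (linfun (Omul al be ga a)))).
  by exists a; [left | apply: cap].
exists (Oconj a); first by right.
apply/cap/(leq_trans _ (dimvS sub)).
lia.
Qed.

Lemma design_division : subspace_design1 V 7 3 2 (assoc_blocks al be ga) ->
  division_alg al be ga.
Proof.
move=> [_ _ uniq] a c ac.
have [->|na] := eqVneq a 0; first by left.
have [->|nc] := eqVneq c 0; first by right.
exfalso.
have lm x : linear (Omul al be ga x) by move=> k y z; apply: omulDZr.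
have nul p q : p != 0 -> p ** q = 0 -> dot q q = 0.
  move=> np pq; have := omul_oconj al be ga p q; rewrite pq omul0l => /esym/eqP.
  by rewrite scaler_eq0 (negPf np) orbF => /eqP.
have daa : dot a a = 0.
  have := oconj_omul al be ga a c; rewrite ac omul0r => /esym/eqP.
  by rewrite scaler_eq0 (negPf nc) orbF => /eqP.
(* A zero divisor is isotropic, so [a] or [a^*] kills a nonzero imaginary [y]; this [y] is again
   isotropic. *)
have [b eb dK] := null_annihilator daa.
have nb : b != 0.
  case: eb => -> //; apply: contraNneq na => ca.
  by apply/eqP/dot_nondeg => t; rewrite dotC dot_def ca omul0r ore0.
set K := (_ :&: V)%VS in dK.
have nK : K != 0%VS by rewrite -dimv_eq0 -lt0n (leq_trans _ dK).
pose y := vpick K; have ny : y != 0 by rewrite vpick0.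
have : y \in K by apply: memv_pick.
rewrite memv_cap memv_ker linfunE // => /andP[/eqP byz Vy].
have dyy := nul _ _ nb byz.
(* The same argument for [y] gives an annihilated space of dimension at least 3 in [V], which
   therefore contains some [z] outside [<y>]. As [y^* = -y], either choice of [b'] yields
   [y z = 0]. *)
have [b' eb' dK'] := null_annihilator dyy.
have /subvPn[z] : ~~ (lker (linfun (Omul al be ga b')) :&: V <= <[y]>)%VS.
  apply/negP => /dimvS; rewrite dim_vline ny => le1.
  by have := leq_trans dK' le1.
rewrite memv_cap memv_ker linfunE // => /andP[/eqP b'z Vz] nz.
have yz : y ** z = 0.
  have cy : Oconj y = - y.
    have := oconj_add y; rewrite (imI Vy) mul0rn scale0r => /eqP.
    by rewrite addr_eq0 => /eqP.
  case: eb' b'z => ->; first by [].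
  rewrite cy -scaleN1r => e; have := omulDZl al be ga (-1) y 0 z.
  by rewrite addr0 omul0l addr0 e scaleN1r => /esym/eqP; rewrite oppr_eq0 => /eqP.
have cyz : cross y z = 0 by rewrite cross_def yz ore0 scale0r subr0.
have fyz : free [:: z; y] by rewrite free_cons seq1_free span_seq1 nz ny.
pose T := <<[:: z; y]>>%VS.
have sTV : (T <= V)%VS by apply/span_subvP => u; rewrite !inE => /orP[] /eqP->.
have [S [[bS sTS] uS]] := uniq T sTV (eqnP fyz).
pose f (t : 'rV[F]_8) : 'rV[F]_2 := \row_i dot t [:: y; z]`_i.
have lf : linear f.
  by move=> k u v; apply/rowP => i; rewrite !mxE dotDl dotZl.
(* Uniqueness puts every imaginary vector orthogonal to [y] and [z] into the single block [S]; two
   linear conditions on [V] leave at least 5 dimensions, but [S] has 3. *)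
have sP : (V :&: lker (linfun f) <= S)%VS.
  apply/subvP => x; rewrite memv_cap => /andP[Vx].
  rewrite memv_ker linfunE // => /eqP fx.
  have dxy : dot x y = 0.
    by have := congr1 (fun M : 'rV[F]_2 => M 0 0) fx; rewrite !mxE.
  have dxz : dot x z = 0.
    by have := congr1 (fun M : 'rV[F]_2 => M 0 1) fx; rewrite !mxE.
  have a0 : asc x z y = 0.
    by rewrite ascC23 asc_cross ?imI // cyz cross0r dxy dxz !scale0r !subr0 scaler0 oppr0.
  case: (mem_or_not x T) => [/(subvP sTS) //|nx].
  have -> : S = <<[:: x; z; y]>>%VS.
    apply: uS; split; last by rewrite (span_cons x) addvSr.
    by apply: block_span3; rewrite // -notin_span2.
  by rewrite memv_span // !inE eqxx.
have := limg_ker_dim (linfun f) V; rewrite dim_im => e7.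
have := dimvS (subvf (linfun f @: V)); rewrite dimvf -[dim _]/2%N => le2.
have [_ dS _] := bS; have := dimvS sP; rewrite dS => le3.
by have := leq_add le3 le2; rewrite e7.
Qed.

(** * Blocks and four-dimensional subalgebras *)

(** A block has a basis [p, q, cross p q], and [cross_cross] expresses the cross products of these
    vectors within their span. *)
Lemma block_closed S x y : assoc_blocks al be ga S -> x \in S -> y \in S -> cross x y \in S.
Proof.
move=> bS; have [sSV dS _] := bS.
have [p [q [Sp Sq nw]]] := cross_pair_exists sSV dS.
have [Vp Vq] := (subvP sSV _ Sp, subvP sSV _ Sq).
have [p0 q0] := (imI Vp, imI Vq); set w := cross p q in nw.
have eS : S = <<[:: p; q; w]>>%VS := block_cross bS Sp Sq nw.
have Sw : w \in S by rewrite eS memv_span // !inE eqxx !orbT.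
have w0 : ore w = 0 by apply: ore_cross.
have Spw : cross p w \in S by rewrite /w cross_cross // memvB ?memvZ.
have Sqw : cross q w \in S.
  by rewrite /w (crossC _ _ _ p0 q0) crossNr memvN cross_cross // memvB ?memvZ.
rewrite {1 2}eS => /span3P[a [b [c ->]]] /span3P[a' [b' [c' ->]]].
rewrite !crossDl !crossDr !crossZl !crossZr !crossxx //.
rewrite (crossC _ _ _ q0 p0) (crossC _ _ _ w0 p0) (crossC _ _ _ w0 q0) -/w.
by rewrite !memvD // !memvZ ?memvN ?mem0v.
Qed.

(** The subalgebra is the span of the unit and [S]: products of elements of [S] are
    [cross s t - dot s t], and [S] is closed under [cross]. *)
Lemma block_subalgebra S : assoc_blocks al be ga S ->
  exists H, [/\ subalgebra al be ga H, \dim H = 4 & S = (H :&: V)%VS].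
Proof.
move=> bS; have [sSV dS _] := bS; exists (<[one]> + S)%VS; split.
- have H1 : one \in (<[one]> + S)%VS by apply: (subvP (addvSl _ _)); apply: memv_line.
  have HS s : s \in S -> s \in (<[one]> + S)%VS by apply/subvP/addvSr.
  split=> // _ _ /memv_addP[_ /vlineP[k ->] [s Ss ->]] /memv_addP[_ /vlineP[l ->] [t St ->]].
  rewrite omulDZl omul1l omulDZr omul1r omul_im ?imI ?(subvP sSV) //.
  have Hst : cross s t \in (<[one]> + S)%VS by apply/HS/block_closed.
  apply: memvD; first by apply/memvZ/memvD; [apply: memvZ | apply: HS].
  apply: memvD; first by apply/memvZ/HS.
  by apply: memvB; last apply: memvZ.
- by rewrite dim_add_one ?dS.
- apply/eqP; rewrite eqEsubv subv_cap addvSr sSV; apply/subvP => u.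
  rewrite memv_cap => /andP[/memv_addP[_ /vlineP[k ->] [s Ss ->]] /imI].
  rewrite oreDZ ore1 (imI (subvP sSV _ Ss)) addr0 mulr1 => ->.
  by rewrite scale0r add0r.
Qed.

(** The imaginary part of [H] is closed under [cross], so by fact (1) it is spanned by some [x],
    [y], [cross x y], whose associator vanishes by alternativity. *)
Lemma subalgebra_block (H : {vspace 'rV[F]_8}) : subalgebra al be ga H -> \dim H = 4 ->
  assoc_blocks al be ga (H :&: V)%VS.
Proof.
move=> [H1 HM] dH; set S := (H :&: V)%VS.
have sSV : (S <= V)%VS by apply: capvSr.
have eH : (<[one]> + S)%VS = H.
  apply/eqP; rewrite eqEsubv subv_add capvSl -memvE H1 /=; apply/subvP => u Hu.
  rewrite -(subrK (ore u *: one) u) addrC memv_add ?memvZ ?memv_line //.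
  by rewrite memv_cap im_part_mem memvB ?memvZ.
have dS : \dim S = 3 by apply/eqP; rewrite -eqSS -dim_add_one // eH dH.
have [x [y [Sx Sy nw]]] := cross_pair_exists sSV dS.
have [Vx Vy] := (subvP sSV _ Sx, subvP sSV _ Sy); set w := cross x y in nw.
have Sw : w \in S.
  rewrite memv_cap cross_mem andbT.
  have -> : w = x ** y + dot x y *: one by rewrite omul_im ?imI // subrK.
  have [Hx Hy] : x \in H /\ y \in H by split; apply: (subvP (capvSl H V)).
  by apply: memvD; [apply: HM | apply: memvZ].
have fw : free [:: w; x; y] by rewrite -notin_span2 ?(free_cross Vy nw).
have -> : S = <<[:: w; x; y]>>%VS.
  apply/eqP; rewrite eq_sym eqEdim dS (eqnP fw) leqnn andbT.
  by apply/span_subvP => u; rewrite !inE => /or3P[] /eqP->.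
by apply: block_span3; rewrite ?cross_mem // asc0_rot ?asc_cross_self.
Qed.
End Cayley.

Theorem mainTheorem3 (F : fieldType) (al be ga : F) :
  (2%:R : F) != 0 -> al != 0 -> be != 0 -> ga != 0 ->
  [/\ q_covering_design (Oim F) 7 3 2 (assoc_blocks al be ga),
      covering_minimal (Oim F) 2 (assoc_blocks al be ga),
      (subspace_design1 (Oim F) 7 3 2 (assoc_blocks al be ga) <->
         division_alg al be ga)
    & forall S : {vspace 'rV[F]_8},
        assoc_blocks al be ga S <->
        exists H : {vspace 'rV[F]_8},
          [/\ subalgebra al be ga H, \dim H = 4%N & S = (H :&: Oim F)%VS]].
Proof.
move=> h2 hal hbe hga; split.
- exact: block_design.
- exact: block_minimal.
- by split; [apply: design_division | apply: division_design].
- move=> S; split; first exact: block_subalgebra.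
  by case=> H [aH dH ->]; apply: subalgebra_block.
Qed.
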